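(* Let $\mathbb P$ be a finite partition with $|\mathbb P|=n$, let $P_0$ be a probability on $\mathcal A(\mathbb P)$, and let $(\underline P,\overline P)$ be a Vertical Barrier Model on $\mathcal A(\mathbb P)$ obtained from $P_0$ with parameters $a,b$, $(a,b)\ne(0,1)$. Then $(\underline P,\overline P)$ is the extended probability interval of its restriction on $\mathbb P$ if and only if one of the following holds: (a) $(\underline P,\overline P)$ is an $\varepsilon$-contamination model; (b) $(\underline P,\overline P)$ is a Pari-Mutuel Model; (c) $|\mathbb P|\le 3$; (d) $|\mathbb P|>3$ and one of the following holds: - $P_0$ is concentrated on one atom of $\mathbb P$ (i.e. $P_0(\omega)=1$ for some $\omega\in\mathbb P$); - $(\underline P,\overline P)$ is the vacuous imprecise probability; - for every $A\in\mathcal A(\mathbb P)\setminus\{\Omega\}$, if $\underline P(A)>0$ then $A$ is made of $n-1$ atoms.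
   Context: A partition $\mathbb P$ is a set of pairwise disjoint non-impossible events (atoms) whose logical sum is the sure event $\Omega$; here $\mathbb P=\{\omega_1,\dots,\omega_n\}$. $\mathcal A(\mathbb P)$ is the powerset of $\mathbb P$ (events are identified with sets of atoms); $\emptyset$ is the impossible event, $\neg$ is complement, and $\omega_i\Rightarrow A$ means that the atom $\omega_i$ belongs to $A$. A probability on $\mathcal A(\mathbb P)$ is an additive function $P_0:\mathcal A(\mathbb P)\to[0,1]$ with $P_0(\Omega)=1$. Vertical Barrier Model (VBM): given a probability $P_0$ on $\mathcal A(\mathbb P)$ and reals $a$, $b>0$ with $0\le a+b\le 1$, $a\le 0$, and $c=1-(a+b)$, it is the pair $(\underline P,\overline P)$ with $\underline P(A)=\max\{bP_0(A)+a,0\}$ for $A\ne\Omega$, $\underline P(\Omega)=1$; $\overline P(A)=\min\{bP_0(A)+c,1\}$ for $A\neq\emptyset$, $\overline P(\emptyset)=0$. Special VBMs: the $\varepsilon$-contamination model is the case $a=0$, $b=\varepsilon<1$ (so $\underline P(A)=\varepsilon P_0(A)$ for $A\ne\Omega$, $\underline P(\Omega)=1$); the Pari-Mutuel Model (PMM) is the case $a=-\delta$, $b=1+\delta$ with $\delta>0$ (so $a+b=1$, $\underline P(A)=\max\{(1+\delta)P_0(A)-\delta,0\}$, $\overline P(A)=\min\{(1+\delta)P_0(A),1\}$); the vacuous imprecise probability has $\underline P(A)=0$ for all $A\ne\Omega$, $\underline P(\Omega)=1$ and $\overline P$ its conjugate. Extended probability interval: $(\underline P,\overline P)$ restricted to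 $\mathbb P$ gives the probability interval with $l_i=\underline P(\omega_i)$, $u_i=\overline P(\omega_i)$, $i=1,\dots,n$. Its extended probability interval is the pair $(l,u)$ of functions on $\mathcal A(\mathbb P)$ given by $l(A)=\max\{\sum_{\omega_i\Rightarrow A}l_i,\ 1-\sum_{\omega_i\Rightarrow\neg A}u_i\}$ and $u(A)=1-l(\neg A)=\min\{\sum_{\omega_i\Rightarrow A}u_i,\ 1-\sum_{\omega_i\Rightarrow\neg A}l_i\}$. The statement that $(\underline P,\overline P)$ is the extended probability interval of its restriction on $\mathbb P$ means $\underline P(A)=l(A)$ and $\overline P(A)=u(A)$ for all $A\in\mathcal A(\mathbb P)$. *)

(* Defs.v *)
From mathcomp Require Import all_boot all_order all_algebra.
From mathcomp Require Import lra.

Set Implicit Arguments.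
Unset Strict Implicit.
Unset Printing Implicit Defensive.

Import Order.TTheory GRing.Theory Num.Theory.
Local Open Scope ring_scope.

(* The partition is a finite type T of atoms and an event is a {set T}: the
   sure event is [set: T], the impossible event is set0, negation is ~: A. *)
Section VerticalBarrier.
Variables (R : realFieldType) (T : finType).
Implicit Types (lP uP : {set T} -> R) (a b : R) (A B : {set T}).

Definition is_probability (P0 : {set T} -> R) : Prop :=
  [/\ forall A, 0 <= P0 A <= 1,
      forall A B, [disjoint A & B] -> P0 (A :|: B) = P0 A + P0 B
    & P0 [set: T] = 1].

Definition vbm_params a b : Prop :=
  [/\ 0 < b, 0 <= a + b <= 1 & a <= 0].

Definition vbm_lower (P0 : {set T} -> R) a b A : R :=
  if A == [set: T] then 1 else Num.max (b * P0 A + a) 0.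

Definition vbm_upper (P0 : {set T} -> R) a b A : R :=
  let c := 1 - (a + b) in
  if A == set0 then 0 else Num.min (b * P0 A + c) 1.

(* These two special models are cases of the parameters (a, b) of the VBM,
   with epsilon = b in the first one; 0 < b and a <= 0 come from vbm_params. *)
Definition is_eps_contamination a b : Prop := a = 0 /\ b < 1.

Definition is_pari_mutuel a b : Prop :=
  exists delta : R, [/\ 0 < delta, a = - delta & b = 1 + delta].

Definition is_vacuous lP uP : Prop :=
  [/\ forall A, A != [set: T] -> lP A = 0,
      lP [set: T] = 1
    & forall A, uP A = 1 - lP (~: A)].

Definition concentrated_on_atom (P0 : {set T} -> R) : Prop := exists w : T, P0 [set w] = 1.

Definition ext_lower (l u : T -> R) A : R :=
  Num.max (\sum_(i in A) l i) (1 - \sum_(i in ~: A) u i).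

Definition ext_upper (l u : T -> R) A : R := 1 - ext_lower l u (~: A).

Lemma ext_upperE (l u : T -> R) A :
  ext_upper l u A =
  Num.min (\sum_(i in A) u i) (1 - \sum_(i in ~: A) l i).
Proof.
rewrite /ext_upper /ext_lower setCK.
set x := \sum_(i in ~: A) l i; set y := \sum_(i in A) u i.
by case: (leP x (1 - y)); case: (leP y (1 - x)); lra.
Qed.

Definition is_ext_prob_interval lP uP : Prop :=
  let l := fun w : T => lP [set w] in
  let u := fun w : T => uP [set w] in
  forall A, lP A = ext_lower l u A /\ uP A = ext_upper l u A.

End VerticalBarrier.

(* Main.v *)
Require Import Defs.
From mathcomp Require Import all_boot all_order all_algebra.
From mathcomp Require Import lra zify.
Import Order.TTheory GRing.Theory Num.Theory.
Local Open Scope ring_scope.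

Set Implicit Arguments.
Unset Strict Implicit.

(** Write [L] and [U] for the lower and upper probability of the model, [l i]
    and [u i] for their values on atoms, and [c = 1 - (a + b)].  [L] and [U]
    are conjugate, so only the lower halves need to be compared.  [L] is
    superadditive and [U] is subadditive, whence both the sum of the [l i] over
    [A] and 1 minus the sum of the [u i] over [~: A] are at most [L A].  Hence
    the model is an extended probability interval exactly when one of these two
    bounds reaches [L A] for every [A] other than the sure event with
    [L A > 0] ([vbm_ext_intervalP]).

    Sufficiency.  The first bound is reached for an epsilon-contamination,
    where [L] is additive below the sure event; for an atom [A]; and for a
    concentrated [P0], whose atom of mass 1 carries the whole value.  The second
    one is reached for a Pari-Mutuel Model, where [U] is a truncated multiple of
    [P0], and for an event missing a single atom.  With at most three
    atoms, every event is trivial, an atom, or the complement of one.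

    Necessity.  Outside the cases of an epsilon-contamination and of a
    Pari-Mutuel Model, [a < 0] and [c > 0].  Subadditivity of [U] is
    then strict on disjoint nonempty events, so the second bound fails as soon
    as [A] misses two atoms ([vbm_upper_sum_strict]).  If such an [A] has [L A > 0], the first bound
    yields an atom [i] with [l i > 0].  If [P0] is not concentrated, another
    atom [j] has positive mass.  With at least four atoms, [[set i; j]] also
    misses two atoms and has positive lower probability, so
    [l i + l j = L [set i; j]].  But this sum is either too small by [- a]
    (when [l j > 0]) or by [b * P0 [set j]] (when [l j = 0]). *)

(** * Set functions and their values on atoms *)

Lemma superadd_sum_atoms (R : realFieldType) (T : finType) (f : {set T} -> R) :
  f set0 = 0 ->
  (forall A B : {set T}, [disjoint A & B] -> f A + f B <= f (A :|: B)) ->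
  forall A : {set T}, \sum_(i in A) f [set i] <= f A.
Proof.
move=> f0 fU A; have [m] := ubnP #|A|; elim: m A => // m IH A cA.
have [->|[x xA]] := set_0Vmem A; first by rewrite big_set0 f0.
rewrite (big_setD1 x) //=.
have IHx : \sum_(i in A :\ x) f [set i] <= f (A :\ x).
  by apply: IH; move: cA; rewrite (cardsD1 x A) xA.
have dx : [disjoint [set x] & A :\ x] by rewrite disjoints1 !inE eqxx.
have := fU _ _ dx; rewrite setD1K //; lra.
Qed.

Lemma subadd_sum_atoms (R : realFieldType) (T : finType) (f : {set T} -> R) :
  f set0 = 0 ->
  (forall A B : {set T}, [disjoint A & B] -> f (A :|: B) <= f A + f B) ->
  forall A : {set T}, f A <= \sum_(i in A) f [set i].
Proof.
move=> f0 fU A; rewrite -lerN2 -sumrN.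
apply: (superadd_sum_atoms (f := fun B => - f B)); first by rewrite f0 oppr0.
by move=> B C dBC; have := fU _ _ dBC; lra.
Qed.

Section Probability.
Variables (R : realFieldType) (T : finType) (P0 : {set T} -> R).
Hypothesis hP0 : is_probability P0.

Lemma prob_ge0 (A : {set T}) : 0 <= P0 A.
Proof. by case: hP0 => h _ _; case/andP: (h A). Qed.

Lemma prob_le1 (A : {set T}) : P0 A <= 1.
Proof. by case: hP0 => h _ _; case/andP: (h A). Qed.

Lemma probT : P0 [set: T] = 1.
Proof. by case: hP0. Qed.

Lemma probU (A B : {set T}) : [disjoint A & B] -> P0 (A :|: B) = P0 A + P0 B.
Proof. by case: hP0 => _ h _; apply: h. Qed.

Lemma prob0 : P0 set0 = 0.
Proof.
have d : [disjoint set0 & (set0 : {set T})] by rewrite -setI_eq0 setI0.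
by have := probU d; rewrite setU0; lra.
Qed.

Lemma probC (A : {set T}) : P0 (~: A) = 1 - P0 A.
Proof.
have d : [disjoint A & ~: A] by rewrite -setI_eq0 setICr.
by have := probU d; rewrite setUCr probT; lra.
Qed.

Lemma prob_sum_atoms (A : {set T}) : P0 A = \sum_(i in A) P0 [set i].
Proof.
apply/eqP; rewrite eq_le; apply/andP; split.
- by apply: subadd_sum_atoms prob0 _ A => B C /probU ->.
- by apply: superadd_sum_atoms prob0 _ A => B C /probU ->.
Qed.

Lemma set0_neqT : (set0 == [set: T]) = false.
Proof.
apply/negP => /eqP e; have := probT; rewrite -e prob0; lra.
Qed.

End Probability.

(** * Bounds on the extended probability interval of the model *)

Section Model.
Variables (R : realFieldType) (T : finType) (P0 : {set T} -> R) (a b : R).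
Hypotheses (hP0 : is_probability P0) (hab : vbm_params a b).
Local Notation L := (vbm_lower P0 a b).
Local Notation U := (vbm_upper P0 a b).
Local Notation l := (fun i : T => L [set i]).
Local Notation u := (fun i : T => U [set i]).

Let b_gt0 : 0 < b. Proof. by case: hab. Qed.

Let bP_ge0 A : 0 <= b * P0 A.
Proof. by rewrite mulr_ge0 ?prob_ge0 // ltW. Qed.

Let bP_leb A : b * P0 A <= b.
Proof. by rewrite ler_piMr ?prob_le1 // ltW. Qed.

Lemma vbm_lowerE (A : {set T}) : A != [set: T] -> L A = Num.max (b * P0 A + a) 0.
Proof. by rewrite /vbm_lower => /negPf ->. Qed.

Lemma vbm_lowerT : L [set: T] = 1.
Proof. by rewrite /vbm_lower eqxx. Qed.

Lemma vbm_upperE (A : {set T}) : A != set0 -> U A = Num.min (b * P0 A + (1 - (a + b))) 1.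
Proof. by rewrite /vbm_upper => /negPf ->. Qed.

Lemma vbm_upper0 : U set0 = 0.
Proof. by rewrite /vbm_upper eqxx. Qed.

Lemma vbm_lower_ge0 (A : {set T}) : 0 <= L A.
Proof. by rewrite /vbm_lower; case: ifP => // _; rewrite le_max lexx orbT. Qed.

Lemma vbm_lower_ge (A : {set T}) : b * P0 A + a <= L A.
Proof.
have [_ /andP[ab_ge0 ab_le1] a_le0] := hab.
rewrite /vbm_lower; case: ifP => _; last by rewrite le_max lexx.
by have := bP_leb A; lra.
Qed.

Lemma vbm_upper_le (A : {set T}) : U A <= b * P0 A + (1 - (a + b)).
Proof.
have [_ /andP[ab_ge0 ab_le1] a_le0] := hab.
rewrite /vbm_upper; case: ifP => _; last by rewrite ge_min lexx.
by have := bP_ge0 A; lra.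
Qed.

Lemma vbm_lower_gt0 (A : {set T}) : A != [set: T] -> 0 < L A -> L A = b * P0 A + a.
Proof. by move=> /vbm_lowerE ->; case: (leP (b * P0 A + a)) => // _; rewrite ltxx. Qed.

Lemma vbm_lower0 : L set0 = 0.
Proof.
have [_ /andP[ab_ge0 ab_le1] a_le0] := hab.
rewrite vbm_lowerE ?(set0_neqT hP0) // (prob0 hP0).
by case: leP; lra.
Qed.

Lemma vbm_upperC (A : {set T}) : U (~: A) = 1 - L A.
Proof.
have [_ /andP[ab_ge0 ab_le1] a_le0] := hab.
rewrite /vbm_upper /vbm_lower -setCT (inj_eq (can_inj (@setCK T))) probC //.
case: ifP => _; first by rewrite subrr.
by case: (leP (b * P0 A + a) 0); case: (leP (_ + (1 - (a + b)))); lra.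
Qed.

(** Since [a <= 0], adding two positive values counts the nonpositive constant
    twice; on the sure event, [L] is 1, which is at least [a + b]. *)
Lemma vbm_lower_superadd (A B : {set T}) :
  [disjoint A & B] -> L A + L B <= L (A :|: B).
Proof.
have [_ /andP[ab_ge0 ab_le1] a_le0] := hab.
move=> dAB.
have [A0|A0] := eqVneq A set0; first by rewrite A0 set0U vbm_lower0 add0r.
have [B0|B0] := eqVneq B set0; first by rewrite B0 setU0 vbm_lower0 addr0.
have AT : A != [set: T].
  by apply: contraNneq B0 => AT; move: dAB; rewrite AT -setI_eq0 setTI.
have BT : B != [set: T].
  by apply: contraNneq A0 => BT; move: dAB; rewrite BT -setI_eq0 setIT.
have PU := probU hP0 dAB.
have := bP_ge0 A; have := bP_ge0 B; have := bP_leb (A :|: B).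
rewrite (vbm_lowerE AT) (vbm_lowerE BT) /vbm_lower PU mulrDr.
case: ifP => _; case: (leP (b * P0 A + a)); case: (leP (b * P0 B + a));
  try lra; by case: (leP (b * P0 A + b * P0 B + a)); lra.
Qed.

(** The constant [c] is counted twice on the right-hand side, or a summand is
    already 1 and the other one is at least [Num.min c 1]: either way there is an
    excess when [c > 0]. *)
Lemma vbm_upper_subadd_strict (A B : {set T}) : a + b < 1 -> A != set0 -> B != set0 ->
  [disjoint A & B] -> U (A :|: B) < U A + U B.
Proof.
have [_ /andP[ab_ge0 ab_le1] a_le0] := hab.
move=> c_gt0 A0 B0 dAB.
have U0 : A :|: B != set0 by rewrite setU_eq0 negb_and A0.
rewrite !vbm_upperE // (probU hP0 dAB) mulrDr.
have := bP_ge0 A; have := bP_ge0 B.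
case: (leP (b * P0 A + _)); case: (leP (b * P0 B + _));
  case: (leP (b * P0 A + b * P0 B + _)); lra.
Qed.

Lemma vbm_upper_subadd (A B : {set T}) : [disjoint A & B] -> U (A :|: B) <= U A + U B.
Proof.
have [_ /andP[ab_ge0 ab_le1] a_le0] := hab.
move=> dAB.
have [->|A0] := eqVneq A set0; first by rewrite set0U vbm_upper0 add0r.
have [->|B0] := eqVneq B set0; first by rewrite setU0 vbm_upper0 addr0.
have U0 : A :|: B != set0 by rewrite setU_eq0 negb_and A0.
rewrite !vbm_upperE // (probU hP0 dAB) mulrDr.
have := bP_ge0 A; have := bP_ge0 B.
case: (leP (b * P0 A + _)); case: (leP (b * P0 B + _));
  case: (leP (b * P0 A + b * P0 B + _)); lra.
Qed.

Lemma vbm_lower_sum (A : {set T}) : \sum_(i in A) l i <= L A.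
Proof. exact: superadd_sum_atoms vbm_lower0 vbm_lower_superadd A. Qed.

Lemma vbm_upper_sum (A : {set T}) : U A <= \sum_(i in A) u i.
Proof. exact: subadd_sum_atoms vbm_upper0 vbm_upper_subadd A. Qed.

Lemma vbm_upper_sum_strict (A : {set T}) : a + b < 1 -> (1 < #|A|)%N ->
  U A < \sum_(i in A) u i.
Proof.
move=> c_gt0 A_gt1.
have /card_gt0P [x xA] : (0 < #|A|)%N by apply: ltnW.
rewrite (big_setD1 x) //= -[in U A](setD1K xA).
apply: lt_le_trans (_ : U [set x] + U (A :\ x) <= _).
  apply: vbm_upper_subadd_strict => //.
  - by rewrite -card_gt0 cards1.
  - by rewrite -card_gt0; move: A_gt1; rewrite (cardsD1 x A) xA.
  - by rewrite disjoints1 !inE eqxx.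
by rewrite lerD2l vbm_upper_sum.
Qed.

Lemma ext_lower_le (A : {set T}) : ext_lower l u A <= L A.
Proof.
rewrite ge_max vbm_lower_sum /=.
by have := vbm_upper_sum (~: A); rewrite vbm_upperC; lra.
Qed.

Lemma ext_lower_ge0 (A : {set T}) : 0 <= ext_lower l u A.
Proof. by rewrite le_max sumr_ge0 // => i _; apply: vbm_lower_ge0. Qed.

(** The upper half follows from the lower one by conjugacy, and the lower half
    is automatic on the sure event (where the second bound is 1) and on events
    with vanishing lower probability. *)
Lemma vbm_ext_intervalP :
  is_ext_prob_interval L U <->
  forall A : {set T}, A != [set: T] -> 0 < L A ->
    L A <= \sum_(i in A) l i \/ L A <= 1 - \sum_(i in ~: A) u i.
Proof.
split=> [ext A _ _|tight A].
  by apply/orP; rewrite -le_max; have [-> _] := ext A; apply: lexx.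
have lowE B : L B = ext_lower l u B.
  apply: le_anti; rewrite ext_lower_le andbT.
  have [->|BT] := eqVneq B [set: T].
    by rewrite vbm_lowerT le_max setCT big_set0 subr0 lexx orbT.
  have [LB|LB] := ltP 0 (L B); last exact: le_trans LB (ext_lower_ge0 B).
  by rewrite le_max; apply/orP; apply: tight.
split; first exact: lowE.
by rewrite /ext_upper -lowE -vbm_upperC setCK.
Qed.

(** * Sufficient conditions for a tight bound *)

(** With [a = 0] the value [L A] is [b * P0 A], additive in [A], and each [l i]
    is at least its share [b * P0 [set i]]. *)
Lemma eps_contamination_tight (A : {set T}) : is_eps_contamination a b ->
  A != [set: T] -> 0 < L A -> L A <= \sum_(i in A) l i.
Proof.
case=> a0 _ AT LA; rewrite (vbm_lower_gt0 AT LA) a0 addr0.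
rewrite (prob_sum_atoms hP0) mulr_sumr ler_sum // => i _.
by have := vbm_lower_ge [set i]; rewrite a0 addr0.
Qed.

(** With [a + b = 1], each [u i] is at most [b * P0 [set i]], and [L A > 0]
    means that the truncation is inactive at [~: A]. *)
Lemma pari_mutuel_tight (A : {set T}) : is_pari_mutuel a b ->
  A != [set: T] -> 0 < L A -> L A <= 1 - \sum_(i in ~: A) u i.
Proof.
case=> d [_ aE bE] AT LA; rewrite (vbm_lower_gt0 AT LA).
have ab1 : a + b = 1 by lra.
suff : \sum_(i in ~: A) u i <= b * P0 (~: A) by rewrite probC //; lra.
rewrite (prob_sum_atoms hP0) mulr_sumr ler_sum // => i _.
by have := vbm_upper_le [set i]; rewrite ab1 subrr addr0.
Qed.

Lemma concentrated_tight (A : {set T}) : concentrated_on_atom P0 ->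
  A != [set: T] -> 0 < L A -> L A <= \sum_(i in A) l i.
Proof.
have [_ /andP[ab_ge0 ab_le1] a_le0] := hab.
case=> w Pw AT LA; have LE := vbm_lower_gt0 AT LA.
have [wA|wA] := boolP (w \in A).
  rewrite (big_setD1 w) //=.
  have : 0 <= \sum_(i in A :\ w) l i.
    by apply: sumr_ge0 => i _; apply: vbm_lower_ge0.
  by have := vbm_lower_ge [set w]; have := bP_leb A; rewrite LE Pw; lra.
(* An event that misses the atom of mass 1 is null. *)
have dwA : [disjoint [set w] & A] by rewrite disjoints1.
have PA : P0 A = 0.
  have := probU hP0 dwA; have := prob_le1 hP0 ([set w] :|: A).
  by have := prob_ge0 hP0 A; rewrite Pw; lra.
by move: LA; rewrite LE PA mulr0 add0r; lra.
Qed.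

Lemma coatom_tight (A : {set T}) : #|~: A| = 1%N -> L A <= 1 - \sum_(i in ~: A) u i.
Proof.
move=> /eqP /cards1P [x Ax]; have := vbm_upperC A.
by rewrite Ax big_set1 => ->; rewrite subKr.
Qed.

Lemma card_le3_tight (A : {set T}) : (#|T| <= 3)%N -> A != [set: T] -> 0 < L A ->
  L A <= \sum_(i in A) l i \/ L A <= 1 - \sum_(i in ~: A) u i.
Proof.
move=> T3 AT LA.
have A0 : A != set0 by apply: contraTneq LA => ->; rewrite vbm_lower0 ltxx.
have CA0 : ~: A != set0 by rewrite -setCT (inj_eq (can_inj (@setCK T))).
move: A0 CA0; rewrite -!card_gt0 => A0 CA0; have := cardsC A => cAT.
have [/eqP /cards1P [x ->]|A1] := eqVneq #|A| 1%N.
  by left; rewrite big_set1.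
by right; apply: coatom_tight; lia.
Qed.

(** * Necessity *)

Lemma prob_atom_outside i : P0 [set i] <> 1 ->
  exists2 j, j != i & 0 < P0 [set j].
Proof.
move=> Pi; have PC : 0 < P0 (~: [set i]).
  by rewrite probC // subr_gt0 lt_neqAle prob_le1 // andbT; apply/eqP.
have [[j /andP[ji Pj]]|none] :=
    altP (@existsP T (fun j => (j != i) && (0 < P0 [set j]))).
  by exists j.
move: PC; rewrite (prob_sum_atoms hP0) big1 ?ltxx // => j.
rewrite !inE => ji; apply/eqP; move/existsPn: none => /(_ j).
by rewrite ji /= -leNgt => Pj; rewrite eq_le Pj prob_ge0.
Qed.

(** The pair formed by an atom of positive lower probability and another atom of
    positive mass refutes tightness: it leaves two atoms outside because
    there are at least four. *)
Lemma tight_card_coatom (A : {set T}) : a < 0 -> a + b < 1 -> (3 < #|T|)%N ->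
  ~ concentrated_on_atom P0 -> is_ext_prob_interval L U ->
  A != [set: T] -> 0 < L A -> #|A| = (#|T| - 1)%N.
Proof.
move=> a_lt0 c_gt0 T4 nconc /vbm_ext_intervalP tight AT LA.
have lower_tight (B : {set T}) : B != [set: T] -> 0 < L B -> (1 < #|~: B|)%N ->
    L B <= \sum_(i in B) l i.
  move=> BT LB CB; have [//|] := tight B BT LB.
  by have := vbm_upper_sum_strict c_gt0 CB; rewrite vbm_upperC; lra.
have neqT B : (1 < #|~: B|)%N -> B != [set: T].
  by apply: contraTneq => ->; rewrite setCT cards0.
have cC (B : {set T}) : (#|B| + #|~: B| = #|T|)%N by apply: cardsC.
have cAT := cC A.
have CA0 : (0 < #|~: A|)%N.
  by rewrite card_gt0 -setCT (inj_eq (can_inj (@setCK T))).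
have [CA1|CA] := leqP #|~: A| 1; first by lia.
exfalso; have LAsum := lower_tight A AT LA CA.
have [i iA li] : exists2 i, i \in A & 0 < l i.
  have [/existsP [i /andP[iA li]]|none] :=
      boolP [exists i, (i \in A) && (0 < l i)]; first by exists i.
  suff : \sum_(i in A) l i <= 0 by lra.
  by apply: sumr_le0 => i iA; move/existsPn: none => /(_ i);
     rewrite iA /= -leNgt.
have Pi : P0 [set i] <> 1 by move=> Pi; apply: nconc; exists i.
have [j ji Pj] := prob_atom_outside Pi.
have cC1 (k : T) : (1 < #|~: [set k]|)%N by have := cC [set k]; rewrite cards1; lia.
have cC2 : (1 < #|~: [set i; j]|)%N.
  by have := cC [set i; j]; rewrite cards2 eq_sym ji; lia.
have Pij : P0 [set i; j] = P0 [set i] + P0 [set j].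
  by rewrite (probU hP0) // disjoints1 inE eq_sym.
have bPj : 0 < b * P0 [set j] by rewrite mulr_gt0.
have liE := vbm_lower_gt0 (neqT _ (cC1 i)) li.
have Lij := vbm_lower_ge [set i; j]; rewrite Pij mulrDr in Lij.
have Lij0 : 0 < L [set i; j] by lra.
have := lower_tight _ (neqT _ cC2) Lij0 cC2.
rewrite big_setU1 ?inE ?(eq_sym i) //= big_set1 liE.
rewrite (vbm_lowerE (neqT _ (cC1 j))); case: (leP (_ + a)); lra.
Qed.

End Model.

Unset Implicit Arguments.
Set Strict Implicit.

(** * The characterization *)

Theorem proposition7p3 (R : realFieldType) (T : finType) (n : nat)
    (hn : #|T| = n) (P0 : {set T} -> R) (hP0 : is_probability P0)
    (a b : R) (hab : vbm_params a b) (hab01 : (a, b) <> (0, 1)) :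
  is_ext_prob_interval (vbm_lower P0 a b) (vbm_upper P0 a b) <->
  [\/ is_eps_contamination a b,
      is_pari_mutuel a b,
      (n <= 3)%N
    | (3 < n)%N /\
      [\/ concentrated_on_atom P0,
          is_vacuous (vbm_lower P0 a b) (vbm_upper P0 a b)
        | forall A : {set T}, A != [set: T] ->
            0 < vbm_lower P0 a b A -> #|A| = (n - 1)%N]].
Proof.
subst n; split=> [ext|cases].
  have [b_gt0 /andP[_ ab_le1] a_le0] := hab.
  have [a0|a0] := eqVneq a 0.
    constructor 1; split=> //; rewrite lt_neqAle; apply/andP; split; last by lra.
    by apply/eqP => b1; apply: hab01; rewrite a0 b1.
  have a_lt0 : a < 0 by rewrite lt_neqAle a0.
  have [ab1|ab1] := eqVneq (a + b) 1.
    by constructor 2; exists (- a); split; lra.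
  have c_gt0 : a + b < 1 by rewrite lt_neqAle ab1.
  have [T3|T4] := leqP #|T| 3; first by constructor 3.
  constructor 4; split=> //.
  have [/existsP [w /eqP Pw]|none] := boolP [exists w, P0 [set w] == 1].
    by constructor 1; exists w.
  constructor 3 => A; apply: tight_card_coatom => //.
  by case=> w Pw; case/existsP: none; exists w; apply/eqP.
apply/vbm_ext_intervalP => // A AT LA.
case: cases => [eps|pmm|T3|[T4 [conc|[vac _ _]|coatom]]].
- by left; apply: eps_contamination_tight.
- by right; apply: pari_mutuel_tight.
- exact: card_le3_tight.
- by left; apply: concentrated_tight.
- by move: LA; rewrite vac // ltxx.
- right; apply: coatom_tight => //.
  by have := cardsC A; have := coatom A AT LA; lia.
Qed.
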